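(* Let $R$ be a Dedekind domain and $n\ge0$. The perverse Eilenberg–MacLane space $\mathtt K(R,n,[1],\bar0)$ is homotopically equivalent in $\mathrm{Sset}_{[1]}$ to $$(\mathtt n\circ\mathcal R)(\Delta[1]\times K(R,n))=(\Delta[1]\times K(R,n))/(\Delta[0]\times K(R,n)),$$ where $\bar 0$ is the zero perversity on $[1]=\{0<1\}$, $\Delta[1]\times K(R,n)$ is viewed over $\Delta[1]$ by projection, and in the quotient $\Delta[0]\times K(R,n)$ is the part over the vertex $0$, collapsed to $\Delta[0]$ by projection.
   Context: **Simplicial sets over $[1]$.** $N([1])=\Delta[1]$, and $\mathrm{Sset}_{[1]}$ is the category of simplicial maps $\Psi_K\colon K\to\Delta[1]$ with simplicial maps over $\Delta[1]$, equivalently of presheaves on the category $\Delta[[1]]$ of simplices of $\Delta[1]$. For a simplicial set $L$, $\Psi_K\otimes L$ is $K\times L\to K\to\Delta[1]$; $\mathrm{Hom}^\Delta(\Psi_K,\Psi_{K'})$ has $k$-simplices $\mathrm{Hom}(\Psi_K\otimes\Delta[k],\Psi_{K'})$; two morphisms are homotopic if they are in the same class of $\pi_0\mathrm{Hom}^\Delta$; a homotopy equivalence is a morphism with an inverse up to homotopy in this sense. A simplex of $\Delta[1]$ is regular if its last vertex is $1$. $\mathrm{Sset}_{[1]}^+$ is the category of presheaves on the full subcategory of regular simplices, $\mathcal R\colon\mathrm{Sset}_{[1]}\to\mathrm{Sset}_{[1]}^+$ is restriction, and $\mathtt n\colon\mathrm{Sset}^+_{[1]}\to\mathrm{Sset}_{[1]}$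 extends a presheaf by a one-point set on every non-regular simplex. **Blown-up cochains for $\bar 0$.** $N^*(-)$ denotes normalized simplicial cochains with coefficients in $R$. A simplex of $N([1])$ is $\Delta[a]*\Delta[b]$ with $a,b\ge-1$ not both $-1$ ($a+1$ vertices over $0$, $b+1$ vertices over $1$; $-1$ means empty); it is regular iff $b\ge0$. Let $c\Delta[a]$ be the cone with apex $v$ as last vertex, $c\emptyset=\{v\}$. For regular simplices set $\widetilde N^*(\Delta[a]*\Delta[b])=N^*(c\Delta[a])\otimes N^*(\Delta[b])$ (equal to $N^*(\Delta[b])$ if $a=-1$), with basis $\mathbf 1_{(F_0,\varepsilon)}\otimes\mathbf 1_{F_1}$, where $(F_0,0)$ is a non-empty face $F_0$ of $\Delta[a]$ and $(F_0,1)$ is $cF_0$ with $F_0$ a possibly empty face. The perverse degree along $0$ of such a basis element is $\dim F_1$ if $\varepsilon=0$ and $-\infty$ if $\varepsilon=1$; of a linear combination, the maximum over the terms with non-zero coefficient ($-\infty$ for $0$). $\widetilde N^*_{\bar 0}(\Delta[a]*\Delta[b])$ consists of the $\omega$ such that $\omega$ and $\delta\omega$ have perverse degree $\le0$. Put $\widetilde N^*_{\bar 0}=0$ on non-regular simplices. With restriction along maps of simplices over $\Delta[1]$ (for a simplex with no vertex over $0$, via the restriction $N^*(c\Delta[a])\to N^*(\{v\})=R$), this is a presheaf on the simplices of $\Delta[1]$. **Eilenberg–MacLane spaces.** $\mathtt K(R,n,[1],\bar0)\in\mathrm{Sset}_{[1]}$ is the presheaf $\sigma\mapsto\mathcal Z^n\widetilde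 N^*_{\bar0}(\sigma)$ (degree $n$ cocycles). The classical $K(R,n)$ is the simplicial set with $k$-simplices $\mathcal Z^nN^*(\Delta[k];R)$. *)

(* Defs.v *)
From HB Require Import structures.
From mathcomp Require Import all_boot all_order all_algebra.
From mathcomp Require Import ring_quotient generic_quotient fraction mxpoly.
From mathcomp Require Import boolp.
From Stdlib Require Import Relation_Operators.

Set Implicit Arguments.
Unset Strict Implicit.
Unset Printing Implicit Defensive.

Import GRing.Theory.
Local Open Scope ring_scope.
#[local] Obligation Tactic := idtac.

(* Mathcomp ideals (idealr_closed) are proper; the unit ideal is trivially
   finitely generated. *)
Definition noetherian (R : idomainType) : Prop :=
  forall I : {pred R}, idealr_closed I ->
    exists (m : nat) (g : 'I_m -> R), forall x,
      x \in I <-> exists a : 'I_m -> R, x = \sum_(i < m) a i * g i.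

Definition integrally_closed (R : idomainType) : Prop :=
  forall z : {fraction R},
    integralOver (@FracField.tofrac R) z -> exists x : R, z = FracField.tofrac x.

Definition maximal_ideal (R : idomainType) (I : {pred R}) : Prop :=
  idealr_closed I /\
  forall J : {pred R}, idealr_closed J -> {subset I <= J} -> {subset J <= I}.

(* Fields are included. *)
Definition dedekind (R : idomainType) : Prop :=
  [/\ noetherian R, integrally_closed R &
      forall I : {pred R}, idealr_closed I -> prime_idealr_closed I ->
        (exists2 x, x \in I & x != 0) -> maximal_ideal I].

Record cat := Cat {
  ob :> Type;
  hom : ob -> ob -> Type;
  idh : forall x, hom x x;
  comph : forall x y z, hom y z -> hom x y -> hom x z;
  comph1 : forall x y (f : hom x y), comph f (idh x) = f;
  comp1h : forall x y (f : hom x y), comph (idh y) f = f;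
  comphA : forall x y z t (f : hom z t) (g : hom y z) (h : hom x y),
    comph f (comph g h) = comph (comph f g) h }.

Record psh (C : cat) := Psh {
  val_at :> C -> Type;
  act : forall x y : C, hom x y -> val_at y -> val_at x;
  act_id : forall (x : C) (u : val_at x), act (idh x) u = u;
  act_comp : forall (x y z : C) (f : hom y z) (g : hom x y) (u : val_at z),
    act (comph f g) u = act g (act f u) }.

Record pmap (C : cat) (P Q : psh C) := PMap {
  pmap_fun :> forall x : C, P x -> Q x;
  pmap_nat : forall (x y : C) (f : hom x y) (u : P y),
    @pmap_fun x (act f u) = act f (@pmap_fun y u) }.
Arguments pmap_fun {C P Q} _ _ _.
Arguments PMap {C P Q} _ _.

Lemma pmap_eq (C : cat) (P Q : psh C) (f g : pmap P Q) :
  (forall x (u : P x), f x u = g x u) -> f = g.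
Proof.
case: f g => [f fn] [g gn] /= fg.
have e : f = g.
  by apply: functional_extensionality_dep => x; apply: funext => u; exact: fg.
by case: g / e gn {fg} => gn; congr PMap; exact: Prop_irrelevance.
Qed.

Definition pmap_id (C : cat) (P : psh C) : pmap P P :=
  @PMap C P P (fun _ u => u) (fun _ _ _ _ => erefl).

Program Definition pmap_comp (C : cat) (P Q S : psh C)
    (g : pmap Q S) (f : pmap P Q) : pmap P S :=
  @PMap C P S (fun x u => g x (f x u)) _.
Next Obligation. by move=> *; rewrite /= !pmap_nat. Qed.

Program Definition full_sub (C : cat) (D : pred C) : cat :=
  @Cat {x : C | D x} (fun x y => hom (sval x) (sval y))
    (fun x => idh (sval x)) (fun x y z f g => comph f g) _ _ _.
Next Obligation. by move=> *; exact: comph1. Qed.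
Next Obligation. by move=> *; exact: comp1h. Qed.
Next Obligation. by move=> *; exact: comphA. Qed.

Program Definition restr (C : cat) (D : pred C) (P : psh C) :
    psh (full_sub D) :=
  @Psh (full_sub D) (fun x => P (sval x))
    (fun x y f u => @act C P (sval x) (sval y) f u) _ _.
Next Obligation. by move=> C D P x u; exact: act_id. Qed.
Next Obligation. by move=> C D P x y z f g u; exact: act_comp. Qed.

Section Delta.
Variables m n : nat.
Definition monotone (f : {ffun 'I_m.+1 -> 'I_n.+1}) :=
  [forall i : 'I_m.+1, forall j : 'I_m.+1, (i <= j)%N ==> (f i <= f j)%N].
Record delta := MkDelta { dfun :> {ffun 'I_m.+1 -> 'I_n.+1}; _ : monotone dfun }.
HB.instance Definition _ := [isSub for dfun].
HB.instance Definition _ := [Finite of delta by <:].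

Lemma delta_mono (f : delta) (i j : 'I_m.+1) : (i <= j)%N -> (f i <= f j)%N.
Proof. by case: f => f /= /forallP/(_ i)/forallP/(_ j)/implyP. Qed.

Lemma deltaP (f g : delta) : (forall i, f i = g i) -> f = g.
Proof. by move=> fg; apply/val_inj/ffunP. Qed.

Lemma monotoneP (f : 'I_m.+1 -> 'I_n.+1) :
  (forall i j : 'I_m.+1, (i <= j)%N -> (f i <= f j)%N) -> monotone (finfun f).
Proof. by move=> h; do 2 apply/forallP=> ?; rewrite !ffunE; apply/implyP/h. Qed.

Definition mkdelta (f : 'I_m.+1 -> 'I_n.+1) h : delta :=
  MkDelta (@monotoneP f h).

Lemma mkdeltaE f h i : @mkdelta f h i = f i.
Proof. exact: ffunE. Qed.
End Delta.

Definition did (n : nat) : delta n n :=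
  @mkdelta n n (fun i => i) (fun _ _ h => h).

Definition dcomp (m n p : nat) (f : delta n p) (g : delta m n) : delta m p :=
  mkdelta (fun (i j : 'I_m.+1) h => delta_mono f (delta_mono g h)).

Lemma dcompE m n p (f : delta n p) (g : delta m n) i : dcomp f g i = f (g i).
Proof. exact: mkdeltaE. Qed.

Lemma coface_mono n (i : 'I_n.+2) (j k : 'I_n.+1) :
  (j <= k)%N -> (lift i j <= lift i k)%N.
Proof. by rewrite /= leq_bump2. Qed.

Definition coface (n : nat) (i : 'I_n.+2) : delta n n.+1 :=
  mkdelta (@coface_mono n i).

Lemma dcompf1 m n (f : delta m n) : dcomp f (did m) = f.
Proof. by apply: deltaP => i; rewrite dcompE mkdeltaE. Qed.

Lemma dcomp1f m n (f : delta m n) : dcomp (did n) f = f.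
Proof. by apply: deltaP => i; rewrite dcompE mkdeltaE. Qed.

Lemma dcompA m n p q (f : delta p q) (g : delta n p) (h : delta m n) :
  dcomp f (dcomp g h) = dcomp (dcomp f g) h.
Proof. by apply: deltaP => i; rewrite !dcompE. Qed.

Definition DeltaCat : cat := @Cat nat delta did dcomp dcompf1 dcomp1f dcompA.

Notation sset := (psh DeltaCat).

Definition Delta (n : nat) : sset :=
  @Psh DeltaCat (fun m => delta m n) (fun m k f u => dcomp u f)
    (fun _ u => dcompf1 u)
    (fun _ _ _ f g u => dcompA u f g).

Definition Delta_map (m n : nat) (f : delta m n) : pmap (Delta m) (Delta n) :=
  @PMap DeltaCat (Delta m) (Delta n) (fun k u => dcomp f u)
    (fun _ _ g u => dcompA f u g).

Program Definition sprod (K L : sset) : sset :=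
  @Psh DeltaCat (fun k => (K k * L k)%type)
    (fun m k f u => (act f u.1, act f u.2)) _ _.
Next Obligation. by move=> K L k [u v]; rewrite !act_id. Qed.
Next Obligation. by move=> K L m n k f g [u v]; rewrite !act_comp. Qed.

Definition spr1 (K L : sset) : pmap (sprod K L) K :=
  @PMap DeltaCat (sprod K L) K (fun _ u => u.1) (fun _ _ _ _ => erefl).

Program Definition sprod_map (K K' L L' : sset) (f : pmap K K') (g : pmap L L') :
    pmap (sprod K L) (sprod K' L') :=
  @PMap DeltaCat (sprod K L) (sprod K' L') (fun k u => (f k u.1, g k u.2)) _.
Next Obligation. by move=> *; rewrite /= !pmap_nat. Qed.

(* The full subcomplex of Delta n on the vertices in A; empty if A is. *)
Lemma fullface_act n (A : pred 'I_n.+1) m k (f : delta m k)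
    (u : {u : delta k n | [forall i, A (u i)]}) :
  [forall i, A (dcomp (sval u) f i)].
Proof. by case: u => u /= /forallP h; apply/forallP => i; rewrite dcompE. Qed.

Program Definition fullface (n : nat) (A : pred 'I_n.+1) : sset :=
  @Psh DeltaCat (fun k => {u : delta k n | [forall i, A (u i)]})
    (fun m k f u => exist _ (dcomp (sval u) f) (fullface_act f u)) _ _.
Next Obligation. by move=> n A k u; apply: val_inj; exact: dcompf1. Qed.
Next Obligation.
by move=> n A m k l f g u; apply: val_inj; exact: dcompA.
Qed.

(* pi_0 of L as an equivalence relation on the vertices of L. *)
Definition same_pi0 (L : sset) : L 0%N -> L 0%N -> Prop :=
  clos_refl_sym_trans (L 0%N) (fun x y => exists e : L 1%N,
    act (coface ord_max : @hom DeltaCat 0%N 1%N) e = x /\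
    act (coface ord0 : @hom DeltaCat 0%N 1%N) e = y).

Section Quotient.
Variables (K : sset) (e : forall k : nat, K k -> K k -> Prop).
Hypothesis e_refl : forall k (u : K k), e u u.
Hypothesis e_sym : forall k (u v : K k), e u v -> e v u.
Hypothesis e_trans : forall k (u v w : K k), e u v -> e v w -> e u w.
Hypothesis e_act : forall m k (f : @hom DeltaCat m k) (u v : K k),
  e u v -> e (act f u) (act f v).

Definition erel (k : nat) : rel {classic (K k)} := fun u v => `[< e u v >].

Lemma erel_refl k : reflexive (@erel k).
Proof. by move=> u; apply/asboolP. Qed.
Lemma erel_sym k : symmetric (@erel k).
Proof. by move=> u v; apply/asboolP/asboolP; exact: e_sym. Qed.
Lemma erel_trans k : transitive (@erel k).
Proof. by move=> v u w /asboolP uv /asboolP /(e_trans uv) ?; apply/asboolP. Qed.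

Canonical erel_equiv k := EquivRel (@erel k) (@erel_refl k) (@erel_sym k) (@erel_trans k).

Definition quo (k : nat) : Type := {eq_quot @erel k}%qT.
Definition to_quo (k : nat) (u : K k) : quo k := (\pi_({eq_quot @erel k}%qT) u)%qT.
Definition of_quo (k : nat) (c : quo k) : K k :=
  repr (c : {eq_quot @erel k}%qT).

Lemma of_quoK k (c : quo k) : to_quo (of_quo c) = c.
Proof. exact: reprK. Qed.

Lemma to_quoP k (u v : K k) : to_quo u = to_quo v <-> e u v.
Proof. by split=> [/eqmodP/asboolP|h] //; apply/eqmodP/asboolP. Qed.

Lemma act_to_quo m k (f : @hom DeltaCat m k) (u : K k) :
  to_quo (act f (of_quo (to_quo u))) = to_quo (act f u).
Proof. by apply/to_quoP/e_act/to_quoP; exact: of_quoK. Qed.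

Program Definition squot : sset :=
  @Psh DeltaCat quo (fun m k f c => to_quo (act f (of_quo c))) _ _.
Next Obligation.
by move=> k c; rewrite -[RHS]of_quoK; congr to_quo; exact: act_id.
Qed.
Next Obligation.
by move=> m n k f g c; symmetry; apply: etrans (act_to_quo g _) _; rewrite -act_comp.
Qed.

Program Definition squot_pi : pmap K squot :=
  @PMap DeltaCat K squot to_quo _.
Next Obligation. by move=> m k f u; rewrite /= act_to_quo. Qed.

Program Definition squot_lift (L : sset) (f : pmap K L)
    (fe : forall k (u v : K k), e u v -> f k u = f k v) : pmap squot L :=
  @PMap DeltaCat squot L (fun k c => f k (of_quo c)) _.
Next Obligation.
move=> L f fe m k g c; rewrite -pmap_nat; apply: fe; apply/to_quoP.
by rewrite of_quoK.
Qed.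
End Quotient.

Record sset1 := Sset1 { tot :> sset; psi : pmap tot (Delta 1) }.

Record map1 (K K' : sset1) := Map1 {
  map1_map :> pmap K K';
  map1_psi : forall k (u : K k), psi K' k (map1_map k u) = psi K k u }.

Lemma map1_eq (K K' : sset1) (f g : map1 K K') :
  (forall k (u : K k), f k u = g k u) -> f = g.
Proof.
case: f g => [f fp] [g gp] /= /(@pmap_eq _ _ _ f g) e.
by case: g / e gp => gp; congr Map1; exact: Prop_irrelevance.
Qed.

Definition map1_id (K : sset1) : map1 K K := @Map1 K K (pmap_id K) (fun _ _ => erefl).

Program Definition map1_comp (K L M : sset1) (g : map1 L M) (f : map1 K L) :
  map1 K M := @Map1 K M (pmap_comp g f) _.
Next Obligation. by move=> *; rewrite /= !map1_psi. Qed.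

Definition iso1 (K L : sset1) (f : map1 K L) : Prop :=
  exists g : map1 L K, map1_comp g f = map1_id K /\ map1_comp f g = map1_id L.

Definition tens (K : sset1) (L : sset) : sset1 :=
  @Sset1 (sprod K L) (pmap_comp (psi K) (spr1 K L)).

Definition tens_map (K : sset1) (L L' : sset) (f : pmap L L') :
    map1 (tens K L) (tens K L') :=
  @Map1 (tens K L) (tens K L') (sprod_map (pmap_id K) f) (fun _ _ => erefl).

Program Definition HomDelta (K K' : sset1) : sset :=
  @Psh DeltaCat (fun k => map1 (tens K (Delta k)) K')
    (fun m k f h => map1_comp h (tens_map K (Delta_map f))) _ _.
Next Obligation.
move=> K K' k h; apply: map1_eq => m [u v].
by apply: (congr1 (fun w => h m (u, w))); exact: dcomp1f.
Qed.
Next Obligation.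
move=> K K' m n k f g h; apply: map1_eq => l [u v].
apply: (congr1 (fun w => h l (u, w))); symmetry.
exact: dcompA.
Qed.

(* The vertex of HomDelta K K' given by a morphism, through
   K (x) Delta[0] = K. *)
Definition vertex (K K' : sset1) (f : map1 K K') : HomDelta K K' 0%N :=
  map1_comp f (@Map1 (tens K (Delta 0)) K (spr1 K (Delta 0)) (fun _ _ => erefl)).

Definition homotopic (K K' : sset1) (f g : map1 K K') : Prop :=
  same_pi0 (vertex f) (vertex g).

Definition homotopy_equivalence (K K' : sset1) (f : map1 K K') : Prop :=
  exists g : map1 K' K,
    homotopic (map1_comp g f) (map1_id K) /\ homotopic (map1_comp f g) (map1_id K').

Definition homotopy_equivalent (K K' : sset1) : Prop :=
  exists f : map1 K K', homotopy_equivalence f.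

Record simplex1 := Simplex1 { sdim : nat; smap :> delta sdim 1 }.

Lemma simplex1_comp (a b c : simplex1)
    (f : {f : delta (sdim b) (sdim c) | dcomp c f == b})
    (g : {g : delta (sdim a) (sdim b) | dcomp b g == a}) :
  dcomp c (dcomp (sval f) (sval g)) == a.
Proof.
case: f g => f /= /eqP hf [g /= /eqP hg]; apply/eqP.
by rewrite -hg -hf dcompA.
Qed.

Program Definition Simplices : cat :=
  @Cat simplex1 (fun a b => {f : delta (sdim a) (sdim b) | dcomp b f == a})
    (fun a => exist _ (did (sdim a)) _)
    (fun a b c f g => exist _ (dcomp (sval f) (sval g)) (simplex1_comp f g)) _ _ _.
Next Obligation. by move=> a; apply/eqP; exact: dcompf1. Qed.
Next Obligation.
by move=> a b f; apply: val_inj; exact: dcompf1.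
Qed.
Next Obligation.
by move=> a b f; apply: val_inj; exact: dcomp1f.
Qed.
Next Obligation.
by move=> *; apply: val_inj; exact: dcompA.
Qed.

(* fib and total are the two directions of the equivalence between simplicial
   sets over Delta[1] and presheaves on Simplices. *)
Lemma fib_act (K : sset1) (a b : simplex1)
    (f : {f : delta (sdim a) (sdim b) | dcomp b f == a})
    (u : {u : K (sdim b) | psi K (sdim b) u = b}) :
  psi K (sdim a) (act (sval f : @hom DeltaCat _ _) (sval u)) = a.
Proof.
by case: f u => f /= /eqP hf [u /= hu]; rewrite pmap_nat hu.
Qed.

Program Definition fib (K : sset1) : psh Simplices :=
  @Psh Simplices (fun a => {u : K (sdim a) | psi K (sdim a) u = a})
    (fun a b f u => exist _ (act (sval f : @hom DeltaCat _ _) (sval u)) (fib_act f u))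
    _ _.
Next Obligation. by move=> K a [u hu] /=; apply: eq_exist; exact: act_id. Qed.
Next Obligation.
by move=> K a b c f g [u hu] /=; apply: eq_exist; exact: act_comp.
Qed.

Section Total.
Variable P : psh Simplices.

Definition total_at (k : nat) : Type := {s : delta k 1 & P (Simplex1 s)}.

Definition lift_to m k (s : delta k 1) (f : delta m k) :
  @hom Simplices (Simplex1 (dcomp s f)) (Simplex1 s) := exist _ f (eqxx _).

Definition total_act (m k : nat) (f : delta m k) (u : total_at k) : total_at m :=
  existT _ (dcomp (projT1 u) f) (act (lift_to (projT1 u) f) (projT2 u)).

Lemma total_actE m k (f : delta m k) (s : delta k 1) (u : P (Simplex1 s))
    (t : delta m 1) (h : @hom Simplices (Simplex1 t) (Simplex1 s)) :
  sval h = f -> total_act f (existT _ s u) = existT _ t (act h u).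
Proof.
case: h => g gh /= gf; have /= e := eqP gh.
subst g t; rewrite /total_act /=; congr existT; congr (act _ _).
exact: val_inj.
Qed.

Program Definition total_sset : sset := @Psh DeltaCat total_at total_act _ _.
Next Obligation.
move=> k [s u].
by rewrite (@total_actE _ _ _ s u s (idh (Simplex1 s : Simplices))) // act_id.
Qed.
Next Obligation.
move=> m n k f g [s u].
rewrite [total_act f _]/total_act /=.
rewrite (@total_actE _ _ _ s u _ (comph (lift_to s f) (lift_to (dcomp s f) g))) //.
by rewrite act_comp.
Qed.

Definition total : sset1 :=
  @Sset1 total_sset
    (@PMap DeltaCat total_sset (Delta 1) (fun k u => projT1 u) (fun _ _ _ _ => erefl)).
End Total.

Definition regular (a : simplex1) : bool := a ord_max == ord_max.

Notation RegSimplices := (@full_sub Simplices regular).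

Lemma regular_hom (a b : Simplices) : hom a b -> regular a -> regular b.
Proof.
case: a b => [m t] [k s] [f /= /eqP hf]; rewrite /regular /= -hf dcompE => h.
apply/eqP/val_inj/anti_leq; rewrite -ltnS ltn_ord /=.
have h1 : nat_of_ord (s (f ord_max)) = 1%N by rewrite (eqP h).
apply: (@leq_trans (s (f ord_max))); first by rewrite h1.
by apply: delta_mono; rewrite -ltnS.
Qed.

(* The functor n: a family indexed by the proofs of [regular a] is an element of
   P a if a is regular, and is unique otherwise (ext_pt_regular and
   ext_pt_nonregular). *)
Program Definition ext_pt (P : psh RegSimplices) : psh Simplices :=
  @Psh Simplices
    (fun a => forall h : regular a, P (exist _ a h))
    (fun a b f u h => act (f : @hom RegSimplices (exist _ a h)
                                 (exist _ b (regular_hom f h)))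
                          (u (regular_hom f h))) _ _.
Next Obligation.
move=> P a u; apply: functional_extensionality_dep => h.
by rewrite (bool_irrelevance (regular_hom _ h) h); exact: act_id.
Qed.
Next Obligation.
move=> P a b c f g u; apply: functional_extensionality_dep => h.
rewrite (bool_irrelevance (regular_hom (comph f g) h)
          (regular_hom f (regular_hom g h))).
exact: (@act_comp _ P (exist _ a h) (exist _ b (regular_hom g h)) (exist _ c _)).
Qed.

Lemma ext_pt_regular (P : psh RegSimplices) (a : simplex1) (h : regular a) :
  bijective (fun u : ext_pt P a => u h).
Proof.
exists (fun v h' => ecast h0 (P (exist _ a h0)) (bool_irrelevance h h') v).
  move=> u; apply: functional_extensionality_dep => h'.
  by case: h' / (bool_irrelevance h h').
by move=> v; rewrite (Prop_irrelevance (bool_irrelevance h h) erefl).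
Qed.

Lemma ext_pt_nonregular (P : psh RegSimplices) (a : simplex1) :
  ~~ regular a -> exists u : ext_pt P a, forall v, v = u.
Proof.
move=> na; exists (fun h => False_rect _ (negP na h)) => v.
by apply: functional_extensionality_dep => h; case: (negP na h).
Qed.

Definition nR (K : sset1) : sset1 := total (ext_pt (@restr Simplices regular (fib K))).

Definition nR_elt (K : sset1) (k : nat) (u : K k) : nR K k :=
  existT _ (psi K k u) (fun h => exist _ u erefl).

Lemma nR_elt_nat (K : sset1) m k (f : @hom DeltaCat m k) (u : K k) :
  nR_elt (act f u) = act f (nR_elt u).
Proof.
set F := ext_pt (@restr Simplices regular (fib K)).
have key (t : delta m 1) (x : F (Simplex1 t)) :
    psi K m (act f u) = t ->
    (forall h, sval (x h) = act f u) ->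
    nR_elt (act f u) = existT (fun s : delta m 1 => F (Simplex1 s)) t x.
  move=> e; subst t => hx; congr existT.
  apply: functional_extensionality_dep => h.
  by have := hx h; case: (x h) => v hv /= ev; apply: eq_exist.
apply: (key (dcomp (psi K k u) f)) => [|h]; last by [].
exact: pmap_nat.
Qed.

Definition nR_unit (K : sset1) : map1 K (nR K) :=
  @Map1 K (nR K) (@PMap DeltaCat K (nR K) (@nR_elt K) (@nR_elt_nat K))
    (fun _ _ => erefl).

Definition over0 (K : sset1) (k : nat) (u : K k) : Prop :=
  forall i, psi K k u i = ord0.

(* Two simplices are identified when they are equal or both lie over the vertex
   0: any two simplices of the same dimension have the same image in Delta[0],
   so this is the collapse along the projection to Delta[0] as soon as the part
   over 0 is not empty. *)
Definition collapse_rel (K : sset1) (k : nat) (u v : K k) : Prop :=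
  u = v \/ over0 u /\ over0 v.

Section Collapse.
Variable K : sset1.

Lemma collapse_refl k (u : K k) : collapse_rel u u.
Proof. by left. Qed.

Lemma collapse_sym k (u v : K k) : collapse_rel u v -> collapse_rel v u.
Proof. by case=> [->|[? ?]]; [left | right]. Qed.

Lemma collapse_trans k (u v w : K k) :
  collapse_rel u v -> collapse_rel v w -> collapse_rel u w.
Proof. by case=> [->//|[hu hv]] [<-|[? ?]]; right. Qed.

Lemma collapse_act m k (f : @hom DeltaCat m k) (u v : K k) :
  collapse_rel u v -> collapse_rel (act f u) (act f v).
Proof.
case=> [->|[hu hv]]; [by left | right].
by split=> i; rewrite pmap_nat [LHS]dcompE.
Qed.

Lemma collapse_psi k (u v : K k) : collapse_rel u v -> psi K k u = psi K k v.
Proof. by case=> [->//|[hu hv]]; apply: deltaP => i; rewrite hu hv. Qed.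

Definition collapse_sset : sset :=
  squot collapse_refl collapse_sym collapse_trans collapse_act.

Definition collapse : sset1 :=
  @Sset1 collapse_sset (squot_lift collapse_refl collapse_sym collapse_trans collapse_act collapse_psi).

Lemma collapse_pi_psi k (u : K k) :
  psi collapse k
    (squot_pi collapse_refl collapse_sym collapse_trans collapse_act k u) =
  psi K k u.
Proof.
apply: collapse_psi; apply/(to_quoP collapse_refl collapse_sym collapse_trans).
exact: of_quoK.
Qed.

Definition collapse_pi : map1 K collapse := Map1 collapse_pi_psi.
End Collapse.

Definition degenerate (L : sset) (k : nat) (x : L k) : Prop :=
  exists (m : nat) (f : @hom DeltaCat k m) (y : L m), (m < k)%N /\ x = act f y.

Definition dface (L : sset) (n : nat) (i : 'I_n.+2) (x : L n.+1) : L n :=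
  act (coface i : @hom DeltaCat n n.+1) x.

Lemma dface_nat (L L' : sset) (u : pmap L L') n (i : 'I_n.+2) (x : L n.+1) :
  u n (dface i x) = dface i (u n.+1 x).
Proof. exact: pmap_nat. Qed.

Lemma degenerate_map (L L' : sset) (u : pmap L L') k (x : L k) :
  degenerate x -> degenerate (u k x).
Proof.
by case=> m [f [y [mk ->]]]; exists m, f, (u m y); rewrite pmap_nat.
Qed.

Section Cochains.
Variable R : comNzRingType.

Definition normalized (L : sset) (n : nat) (c : L n -> R) : Prop :=
  forall x, degenerate x -> c x = 0.

Definition coboundary (L : sset) (n : nat) (c : L n -> R) : L n.+1 -> R :=
  fun x => \sum_(i < n.+2) (-1) ^+ i * c (dface i x).

(* Z^n N^*(L; R) *)
Definition cocycle (L : sset) (n : nat) (c : L n -> R) : Prop :=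
  normalized c /\ forall x, coboundary c x = 0.

Lemma cocycle_pull (L L' : sset) (u : pmap L L') n (c : L' n -> R) :
  cocycle c -> cocycle (fun x => c (u n x)).
Proof.
case=> cn cz; split=> [x xd|x]; first exact/cn/degenerate_map.
by rewrite -[RHS](cz (u n.+1 x)); apply: eq_bigr => i _; rewrite dface_nat.
Qed.

Variable n : nat.

Program Definition EM : sset :=
  @Psh DeltaCat (fun k => {c : Delta k n -> R | cocycle c})
    (fun m k f c =>
       exist _ _ (cocycle_pull (Delta_map (f : delta m k)) (svalP c))) _ _.
Next Obligation.
move=> k [c hc]; apply: eq_exist; apply: funext => x /=.
by congr c; exact: dcomp1f.
Qed.
Next Obligation.
move=> k l m f g [c hc]; apply: eq_exist; apply: funext => x /=.
by congr c; symmetry; exact: dcompA.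
Qed.
End Cochains.

Definition Delta1_EM (R : comNzRingType) (n : nat) : sset1 :=
  tens (@Sset1 (Delta 1) (pmap_id (Delta 1))) (EM R n).

(* The join decomposition Delta[a] * Delta[b] of a simplex s of Delta[1] of
   dimension k is read inside Delta[k]: Delta[a] and Delta[b] are the faces on
   the vertices over 0 and over 1.  The cone c Delta[a] is the face of
   Delta[k + 1] on the vertices of Delta[a] and the apex v, which is the last
   vertex k + 1; [unlift ord_max i] is [None] if i is the apex and [Some j] if i
   is the vertex j of Delta[k]. *)
Definition in_base (s : simplex1) : pred 'I_(sdim s).+1 := fun i => s i == ord_max.

Definition in_cone (s : simplex1) : pred 'I_(sdim s).+2 :=
  fun i => if unlift ord_max i is Some j then s j == ord0 else true.

Definition base (s : simplex1) : sset := fullface (@in_base s).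
Definition cone (s : simplex1) : sset := fullface (@in_cone s).

Definition has_apex (s : simplex1) (p : nat) (x : cone s p) : bool :=
  [exists i, sval x i == ord_max].

(* The map c Delta[a] -> c Delta[a'] and Delta[b] -> Delta[b'] induced by a
   morphism of simplices over Delta[1]. *)
Definition cone_fun (m k : nat) (f : delta m k) (i : 'I_m.+2) : 'I_k.+2 :=
  if unlift ord_max i is Some j then lift ord_max (f j) else ord_max.

Lemma cone_fun_mono m k (f : delta m k) (i j : 'I_m.+2) :
  (i <= j)%N -> (cone_fun f i <= cone_fun f j)%N.
Proof.
rewrite /cone_fun; case: unliftP => [i' ->|->]; case: unliftP => [j' ->|->].
- by rewrite !lift_max; exact: delta_mono.
- by move=> _; exact: leq_ord.
- by rewrite lift_max leqNgt ltn_ord.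
- by [].
Qed.

Definition cone_delta (m k : nat) (f : delta m k) : delta m.+1 k.+1 :=
  mkdelta (cone_fun_mono f).

Section Induced.
Variables (s t : simplex1) (f : @hom Simplices s t).

Lemma vertex_label j : s j = t (sval f j).
Proof. by rewrite -dcompE; congr (dfun _ _); rewrite (eqP (svalP f)). Qed.

Lemma base_map_in p (y : base s p) :
  [forall i, in_base (dcomp (sval f) (sval y) i)].
Proof.
case: y => y /= /forallP h; apply/forallP => i; rewrite /in_base dcompE.
by move: (h i); rewrite /in_base vertex_label.
Qed.

Lemma cone_map_in p (x : cone s p) :
  [forall i, in_cone (dcomp (cone_delta (sval f)) (sval x) i)].
Proof.
have h := forallP (svalP x); apply/forallP => i; rewrite /in_cone dcompE mkdeltaE.
move: (h i); rewrite /in_cone /cone_fun.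
case: (unlift ord_max (sval x i)) => [j|]; last by rewrite unlift_none.
by rewrite liftK vertex_label.
Qed.

Program Definition base_map : pmap (base s) (base t) :=
  @PMap DeltaCat (base s) (base t)
    (fun p y => exist _ (dcomp (sval f) (sval y)) (base_map_in y)) _.
Next Obligation. by move=> *; apply: val_inj; exact: dcompA. Qed.

Program Definition cone_map : pmap (cone s) (cone t) :=
  @PMap DeltaCat (cone s) (cone t)
    (fun p x => exist _ (dcomp (cone_delta (sval f)) (sval x)) (cone_map_in x)) _.
Next Obligation. by move=> *; apply: val_inj; exact: dcompA. Qed.

Lemma cone_mapE p (x : cone s p) i :
  sval (cone_map p x) i = cone_fun (sval f) (sval x i).
Proof. exact: etrans (dcompE _ _ _) (mkdeltaE _ _). Qed.

Lemma has_apex_map p (x : cone s p) : has_apex (cone_map p x) = has_apex x.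
Proof.
apply/existsP/existsP => -[i hi]; exists i; move: hi; rewrite cone_mapE /cone_fun.
  by case: unliftP => [j _|-> //]; rewrite eq_sym (negbTE (neq_lift _ _)).
by move=> /eqP ->; rewrite unlift_none.
Qed.
End Induced.

Section Blowup.
Variable R : comNzRingType.

(* N^*(X) (x) N^*(Y) for finite complexes X and Y is free on the products
   1_x (x) 1_y of the dual basis elements of the non-degenerate simplices x and
   y.  An element is given by its coefficients w p q x y, x in X_p and y in Y_q,
   extended by 0 to degenerate simplices. *)
Definition bicochain (X Y : sset) : Type := forall p q : nat, X p -> Y q -> R.

Definition binormalized (X Y : sset) (w : bicochain X Y) : Prop :=
  forall p q (x : X p) (y : Y q), degenerate x \/ degenerate y -> w p q x y = 0.

Definition of_degree (X Y : sset) (n : nat) (w : bicochain X Y) : Prop :=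
  forall p q (x : X p) (y : Y q), (p + q != n)%N -> w p q x y = 0.

(* delta (a (x) b) = delta a (x) b + (-1)^|a| a (x) delta b *)
Definition bicob1 (X Y : sset) (w : bicochain X Y) : bicochain X Y :=
  fun p q => match p with
    | 0 => fun _ _ => 0
    | p'.+1 => fun x y => coboundary (fun x' : X p' => w p' q x' y) x
    end.

Definition bicob2 (X Y : sset) (w : bicochain X Y) : bicochain X Y :=
  fun p q => match q with
    | 0 => fun _ _ => 0
    | q'.+1 => fun x y => (-1) ^+ p * coboundary (w p q' x) y
    end.

Definition bicob (X Y : sset) (w : bicochain X Y) : bicochain X Y :=
  fun p q x y => bicob1 w x y + bicob2 w x y.

Definition bipull (X X' Y Y' : sset) (u : pmap X X') (v : pmap Y Y')
    (w : bicochain X' Y') : bicochain X Y :=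
  fun p q x y => w p q (u p x) (v q y).

Lemma bicob_pull (X X' Y Y' : sset) (u : pmap X X') (v : pmap Y Y')
    (w : bicochain X' Y') p q (x : X p) (y : Y q) :
  bicob (bipull u v w) x y = bicob w (u p x) (v q y).
Proof.
rewrite /bicob; congr (_ + _).
  case: p x => [//|p] x /=.
  by apply: eq_bigr => i _; rewrite /bipull dface_nat.
case: q y => [//|q] y /=; congr (_ * _).
by apply: eq_bigr => i _; rewrite /bipull dface_nat.
Qed.

(* The perverse degree along 0 of 1_x (x) 1_y, where x = (F0, e) and y = F1:
   [None] stands for -oo. *)
Definition perv_basis (s : simplex1) (p q : nat) (x : cone s p) (y : base s q) :
    option nat :=
  if has_apex x then None else Some q.

(* The perverse degree of w, the maximum over its terms with non-zero
   coefficient, is at most d. *)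
Definition perv_le (s : simplex1) (w : bicochain (cone s) (base s)) (d : nat) :
    Prop :=
  forall p q (x : cone s p) (y : base s q), w p q x y <> 0 ->
    if perv_basis x y is Some e then (e <= d)%N else true.

Lemma perv_le_pull (s t : simplex1) (f : @hom Simplices s t)
    (w : bicochain (cone t) (base t)) (w' : bicochain (cone s) (base s)) d :
  (forall p q (x : cone s p) (y : base s q),
     w' p q x y = w p q (cone_map f p x) (base_map f q y)) ->
  perv_le w d -> perv_le w' d.
Proof.
by move=> e h p q x y; rewrite e => /h; rewrite /perv_basis has_apex_map.
Qed.

Variable n : nat.

(* The degree n part of the blown-up cochains for the perversity 0. *)
Record perv_cochain (s : simplex1) (w : bicochain (cone s) (base s)) : Prop := {
  pc_norm : binormalized w;
  pc_deg : of_degree n w;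
  pc_nonregular : ~~ regular s ->
    forall p q (x : cone s p) (y : base s q), w p q x y = 0;
  pc_perv : perv_le w 0;
  pc_perv_cob : perv_le (bicob w) 0 }.

Definition perv_cocycle (s : simplex1) (w : bicochain (cone s) (base s)) : Prop :=
  perv_cochain w /\
  forall p q (x : cone s p) (y : base s q), bicob w x y = 0.

Lemma base_regular (s : simplex1) q (y : base s q) : regular s.
Proof.
case: y => y /forallP /(_ ord0) /eqP h; apply/eqP/val_inj/anti_leq.
rewrite -ltnS ltn_ord /=; apply: (@leq_trans (s (y ord0))); first by rewrite h.
by apply: delta_mono; rewrite -ltnS.
Qed.

Lemma perv_cocycle_pull (s t : simplex1) (f : @hom Simplices s t)
    (w : bicochain (cone t) (base t)) :
  perv_cocycle w -> perv_cocycle (bipull (cone_map f) (base_map f) w).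
Proof.
case=> -[wn wd wr wp wpc] wc; split; last first.
  by move=> p q x y; rewrite bicob_pull.
split.
- move=> p q x y h; apply: wn.
  by case: h => h; [left | right]; exact: degenerate_map.
- by move=> p q x y h; exact: wd.
- by move=> sr p q x y; case/negP: sr; exact: base_regular y.
- exact: (perv_le_pull (f := f)) wp.
- by apply: (perv_le_pull (f := f)) wpc => *; exact: bicob_pull.
Qed.

Program Definition KpervPsh : psh Simplices :=
  @Psh Simplices
    (fun s => {w : bicochain (cone s) (base s) | perv_cocycle w})
    (fun s t f w => exist _ _ (perv_cocycle_pull f (svalP w))) _ _.
Next Obligation.
move=> s [w hw]; apply: eq_exist.
do 4 apply: functional_extensionality_dep => ?.
rewrite /bipull; congr w; apply: val_inj => /=; last exact: dcomp1f.
apply: deltaP => i; rewrite dcompE mkdeltaE /cone_fun.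
by case: unliftP => [j ->|->] //; rewrite mkdeltaE.
Qed.
Next Obligation.
move=> s t r f g [w hw]; apply: eq_exist.
do 4 apply: functional_extensionality_dep => ?.
rewrite /bipull; congr w; apply: val_inj => /=; last by rewrite dcompA.
apply: deltaP => i; rewrite !dcompE !mkdeltaE /cone_fun.
case: (unlift ord_max _) => [j|]; last by rewrite unlift_none.
by rewrite liftK dcompE.
Qed.

(* K(R, n, [1], 0), as a simplicial set over Delta[1] *)
Definition Kperv : sset1 := total KpervPsh.
End Blowup.

(* Main.v *)
(** The two spaces are isomorphic. On a regular simplex
    Delta[a] * Delta[b], the non-degenerate simplices of the join that meet
    Delta[b] are the x' * y, with x' a possibly empty face of Delta[a], and
    correspond to the products 1_{x' * v} (x) 1_y. The perverse condition on w
    and on its coboundary forces the remaining part of w into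
    N^*(Delta[a]) (x) R, R being the constants of N^0(Delta[b]). Hence
      w (x' * v, y) = c (x' * y),  w (x, y0) = c x
    identifies the blown-up cochains with N^*(Delta[a] * Delta[b]), without
    signs and compatibly with the differentials. *)

From mathcomp Require Import all_boot all_algebra.
From mathcomp Require Import boolp zify.
From Stdlib Require Import Relation_Operators.
Require Import Defs.

Set Implicit Arguments.
Unset Strict Implicit.
Unset Printing Implicit Defensive.

Import GRing.Theory.
Local Open Scope ring_scope.

(** * Isomorphisms over Delta[1] *)

Lemma levelwise_bij_iso1 (K L : sset1) (f : map1 K L) :
  (forall k, injective (f k)) -> (forall k v, exists u, f k u = v) -> iso1 f.
Proof.
move=> finj fsurj.
have [g gK] : {g : forall k, L k -> K k | forall k v, f k (g k v) = v}.
  exists (fun k v => sval (cid (fsurj k v))) => k v.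
  exact: (svalP (cid (fsurj k v))).
have gnat (m k : DeltaCat) (h : hom m k) (v : L k) : g m (act h v) = act h (g k v).
  by apply: finj; rewrite gK pmap_nat gK.
have gpsi k (v : L k) : psi K k (g k v) = psi L k v by rewrite -{2}(gK k v) map1_psi.
exists (@Map1 L K (PMap g gnat) gpsi); split; apply: map1_eq => k u /=.
  by apply: finj; rewrite gK.
exact: gK.
Qed.

Lemma iso1_homotopy_equivalent (K L : sset1) (f : map1 L K) :
  iso1 f -> homotopy_equivalent K L.
Proof.
case=> g [gf fg]; exists g, f.
by split; rewrite ?gf ?fg; exact: rst_refl.
Qed.

Section TotalMap.
Variables (P Q : psh Simplices) (f : pmap P Q).

Lemma total_map_nat (m k : DeltaCat) (h : hom m k) (u : total P k) :
  existT (fun s => Q (Simplex1 s)) (projT1 (act h u)) (f _ (projT2 (act h u))) =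
  @act DeltaCat (total Q) m k h (existT _ (projT1 u) (f _ (projT2 u))).
Proof. by case: u => s u; congr existT; exact: pmap_nat. Qed.

Definition total_map : map1 (total P) (total Q) :=
  @Map1 (total P) (total Q) (@PMap DeltaCat (total P) (total Q) _ total_map_nat)
    (fun _ _ => erefl).

Lemma total_map_iso :
  (forall s, injective (f s)) -> (forall s v, exists u, f s u = v) ->
  iso1 total_map.
Proof.
move=> finj fsurj; apply: levelwise_bij_iso1 => k.
  move=> [s u] [t v] /= e; have st : s = t := congr1 (@projT1 _ _) e.
  subst t; congr existT; apply: finj; exact: (eq_from_Tagged e).
move=> [s v]; have [u <-] := fsurj _ v.
by exists (existT _ s u).
Qed.
End TotalMap.

(** * Vertices of simplices *)

(* Past the dimension of u its last vertex is repeated. *)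
Definition vtx m k (u : delta m k) (i : nat) : 'I_k.+1 := u (inord (minn i m)).

Lemma vtx_le m k (u : delta m k) i j : (i <= j)%N -> (vtx u i <= vtx u j)%N.
Proof. by move=> ij; apply: delta_mono; rewrite !inordK; lia. Qed.

Lemma vtx_ord m k (u : delta m k) (i : 'I_m.+1) : vtx u i = u i.
Proof.
congr (dfun _ _); apply: val_inj; have im := ltn_ord i.
by rewrite /= inordK; lia.
Qed.

Lemma vtx_clamp m k (u : delta m k) i : vtx u (minn i m) = vtx u i.
Proof. by rewrite /vtx -minnA minnn. Qed.

Lemma vtx_last m k (u : delta m k) i : (m <= i)%N -> vtx u i = vtx u m.
Proof. by move=> mi; rewrite -vtx_clamp; congr vtx; lia. Qed.

Lemma delta_vtx m k (u v : delta m k) :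
  (forall i, (i <= m)%N -> vtx u i = vtx v i) -> u = v.
Proof. by move=> uv; apply: deltaP => i; rewrite -!vtx_ord uv // -ltnS. Qed.

Lemma vtx_dcomp m k l (f : delta k l) (u : delta m k) i :
  vtx (dcomp f u) i = f (vtx u i).
Proof. exact: dcompE. Qed.

Lemma vtx_coface m k (u : delta m.+1 k) (i : 'I_m.+2) j :
  (j <= m)%N -> vtx (dcomp u (coface i)) j = vtx u (bump i j).
Proof.
move=> jm; rewrite /vtx dcompE mkdeltaE; congr (dfun _ _); apply: val_inj => /=.
by rewrite !inordK /bump; lia.
Qed.

(** For [i = m + 1] and [j > m] the two sides clamp to the vertices [m] and [m + 1] of [u]; for
    [i <= m] the last vertex survives, and the formula holds at every index. *)
Lemma vtx_coface_in m k (u : delta m.+1 k) (i : 'I_m.+2) j :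
  (i <= m)%N -> vtx (dcomp u (coface i)) j = vtx u (bump i j).
Proof.
move=> im; rewrite -vtx_clamp vtx_coface; last by lia.
by rewrite -[LHS]vtx_clamp -[RHS]vtx_clamp; congr vtx; rewrite /bump; lia.
Qed.

Section FromNat.
Variables (m k : nat) (F : nat -> 'I_k.+1).
Hypothesis Fmono : forall i j, (i <= j)%N -> (F i <= F j)%N.

Lemma delta_of_nat_mono (i j : 'I_m.+1) : (i <= j)%N -> (F i <= F j)%N.
Proof. exact: Fmono. Qed.

Definition delta_of_nat : delta m k := mkdelta delta_of_nat_mono.

Lemma vtx_of_nat i : vtx delta_of_nat i = F (minn i m).
Proof. by rewrite /vtx mkdeltaE inordK //; lia. Qed.
End FromNat.

(** [unbump i] is the codegeneracy taking the value [i] at [i] and [i + 1]; the truncation at [k]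
    extends it to all of [nat], as [delta_of_nat] requires. *)
Lemma codegen_mono k (i : nat) (a b : nat) :
  (a <= b)%N ->
  ((inord (minn (unbump i a) k) : 'I_k.+1) <= (inord (minn (unbump i b) k) : 'I_k.+1))%N.
Proof. by move=> ab; rewrite !inordK /unbump; lia. Qed.

(** The injection [u] lets one proof serve both [Delta d] and its full faces. A monotone map to a
    smaller ordinal repeats a value at consecutive places; conversely, [x] is the [i]-th degeneracy
    of its [i]-th face. *)
Lemma degenerate_vtx (L : sset) d (u : pmap L (Delta d))
    (uinj : forall k, injective (u k)) k (x : L k) :
  degenerate x <-> exists2 i, (i < k)%N & vtx (u k x) i = vtx (u k x) i.+1.
Proof.
split=> [[m [f [y [mk ->]]]]|[i ik e]].
  rewrite pmap_nat /=.
  case: (pselect (exists2 i, (i < k)%N & vtx (f : delta k m) i = vtx (f : delta k m) i.+1)).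
    by case=> i ik fi; exists i => //; rewrite !vtx_dcomp fi.
  move=> nf; suff: (k <= vtx (f : delta k m) k)%N by have := ltn_ord (vtx (f : delta k m) k); lia.
  (* Without a repetition [f] is strictly increasing, so [f i >= i], which at [i = k] contradicts
     [m < k]. *)
  have : forall i, (i <= k)%N -> (i <= vtx (f : delta k m) i)%N.
    elim=> // i IH ik; have le := @vtx_le _ _ (f : delta k m) i i.+1 (leqnSn i).
    have ne : nat_of_ord (vtx (f : delta k m) i) != vtx (f : delta k m) i.+1.
      by apply/eqP => /val_inj fi; apply: nf; exists i.
    by have := IH (ltnW ik); lia.
  exact.
case: k x ik e => // k x ik e.
pose f : delta k.+1 k := delta_of_nat k.+1 (@codegen_mono k i).
exists k, f, (dface (inord i) x); split=> //.
apply: uinj; rewrite !pmap_nat; apply: delta_vtx => j jk /=.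
have fj : nat_of_ord (vtx f j) = unbump i j.
  by rewrite vtx_of_nat inordK /unbump; lia.
rewrite vtx_dcomp -vtx_ord fj vtx_coface; last by rewrite /unbump; lia.
rewrite inordK; last by lia.
case: (ltngtP j i) => ji; last by rewrite ji e; congr vtx; rewrite /bump /unbump; lia.
all: by congr vtx; rewrite /bump /unbump; lia.
Qed.

Definition fullface_incl n (A : pred 'I_n.+1) : pmap (fullface A) (Delta n) :=
  @PMap DeltaCat (fullface A) (Delta n) (fun k u => sval u) (fun _ _ _ _ => erefl).

Lemma degenerate_Delta d k (x : Delta d k) :
  degenerate x <-> exists2 i, (i < k)%N & vtx (x : delta k d) i = vtx (x : delta k d) i.+1.
Proof. exact: (@degenerate_vtx _ _ (pmap_id (Delta d)) (fun _ _ _ e => e)). Qed.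

Lemma degenerate_fullface d (A : pred 'I_d.+1) k (x : fullface A k) :
  degenerate x <-> exists2 i, (i < k)%N & vtx (sval x) i = vtx (sval x) i.+1.
Proof. exact: (@degenerate_vtx _ _ (fullface_incl A) (fun _ _ _ => @val_inj _ _ _ _ _)). Qed.

(** * The join of a simplex of the cone and a simplex of the base *)

Local Arguments dface : simpl never.

Section Join.
Variable s : simplex1.
Local Notation K := (sdim s).

Lemma baseP q (y : base s q) i : s (vtx (sval y) i) = ord_max.
Proof. by apply/eqP; have := forallP (svalP y) (inord (minn i q)). Qed.

Lemma coneP p (x : cone s p) i j :
  unlift ord_max (vtx (sval x) i) = Some j -> s j = ord0.
Proof.
by have := forallP (svalP x) (inord (minn i p)); rewrite /in_cone /vtx => /[swap] -> /eqP.
Qed.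

(** The apex is the largest vertex of Delta[k + 1], so a monotone [x] that meets it ends there. *)
Lemma has_apexE p (x : cone s p) : has_apex x = (vtx (sval x) p == ord_max).
Proof.
apply/existsP/eqP => [[i /eqP xi]|e]; last by exists (inord (minn p p)); rewrite -e.
apply: val_inj; apply/eqP; rewrite eqn_leq leq_ord /=.
rewrite -[X in (X <= _)%N]/(nat_of_ord (@ord_max K.+1)) -xi -vtx_ord; apply: vtx_le.
by rewrite -ltnS.
Qed.

Lemma vtx_apex p (x : cone s p) i : has_apex x -> (p <= i)%N -> vtx (sval x) i = ord_max.
Proof. by rewrite has_apexE => /eqP e /(vtx_last (sval x)) ->. Qed.

(** The truncated subtraction makes every apex at a place up to [p] read the first vertex of [y], so
    repeated apexes of [x] give repeated vertices of the join. *)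
Definition join_vtx p q (x : cone s p) (y : base s q) (i : nat) : 'I_K.+1 :=
  if unlift ord_max (vtx (sval x) i) is Some j then j else vtx (sval y) (i - p).

Lemma join_mono p q (x : cone s p) (y : base s q) i j :
  (i <= j)%N -> (join_vtx x y i <= join_vtx x y j)%N.
Proof.
move=> ij; rewrite /join_vtx; have := vtx_le (sval x) ij.
have := @coneP _ x i; have := @coneP _ x j.
case: unliftP => [j' ->|->]; case: unliftP => [i' ->|->] hj hi.
- by rewrite !lift_max.
- by rewrite lift_max leqNgt ltn_ord.
(* A vertex over 0 cannot lie after a vertex over 1, by monotonicity of [s]. *)
- move=> _; rewrite leqNgt; apply/negP => /ltnW /(delta_mono s).
  by rewrite baseP (hi _ erefl).
- by move=> _; apply: vtx_le; lia.
Qed.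

(* When x = x' * v, this is x' * y; when x does not contain the apex v and
   n = p, this is x. *)
Definition join n p q (x : cone s p) (y : base s q) : delta n K :=
  delta_of_nat n (@join_mono p q x y).

Lemma vtx_join n p q (x : cone s p) (y : base s q) i :
  (i <= n)%N -> vtx (join n x y) i = join_vtx x y i.
Proof. by move=> iN; rewrite vtx_of_nat; congr join_vtx; lia. Qed.

(** The face [i = p + 1] needs [q = 0]: only then is the last place of [x] also the last place of
    the join. *)
Lemma join_dface_cone n p q (x : cone s p.+1) (y : base s q) (i : 'I_p.+2) :
  (p + q)%N = n -> (i <= p)%N || (q == 0%N) ->
  join n (dface i x) y = dcomp (join n.+1 x y) (coface (inord i)).
Proof.
move=> pqn hi; have ip := ltn_ord i.
apply: delta_vtx => l ln; rewrite vtx_coface // inordK; last by lia.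
rewrite !vtx_join //; last by rewrite /bump; lia.
have e : vtx (sval (dface i x)) l = vtx (sval x) (bump i l).
  case/orP: hi => [|/eqP q0]; first exact: vtx_coface_in.
  by apply: vtx_coface; lia.
rewrite /join_vtx e; case: unlift => //; congr vtx; rewrite /bump.
by case/orP: hi => ?; lia.
Qed.

(** These are the x' * v with x' a possibly empty simplex of Delta[a]; every non-degenerate [x]
    containing the apex has this form. *)
Definition single_apex p (x : cone s p) : Prop :=
  has_apex x /\ forall i, (i < p)%N -> vtx (sval x) i != ord_max.

(** The first vertex of [y] takes the place [p] of the apex, hence the shift by [p]. *)
Lemma join_dface_base n p q (x : cone s p) (y : base s q.+1) (j : 'I_q.+2) :
  (p + q)%N = n -> single_apex x ->
  join n x (dface j y) = dcomp (join n.+1 x y) (coface (inord (p + j))).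
Proof.
move=> pqn [xa xn]; have jq := ltn_ord j.
apply: delta_vtx => l ln; rewrite vtx_coface // inordK; last by lia.
rewrite !vtx_join //; last by rewrite /bump; lia.
rewrite /join_vtx; case: (ltnP l p) => lp.
  have -> : bump (p + j) l = l by rewrite /bump; lia.
  by case: unliftP (xn l lp) => // ->; rewrite eqxx.
rewrite !vtx_apex ?unlift_none //; last by rewrite /bump; lia.
rewrite vtx_coface; last by lia.
by congr vtx; rewrite /bump; lia.
Qed.

Lemma join_degenerate n p q (x : cone s p) (y : base s q) :
  (p + q)%N = n -> has_apex x || (q == 0%N) -> degenerate x \/ degenerate y ->
  degenerate (join n x y : Delta K n).
Proof.
move=> pqn xq [] /degenerate_fullface [i ik e]; apply/degenerate_Delta.
  exists i; first by lia.
  rewrite !vtx_join; [|lia..]; rewrite /join_vtx e; case: unlift => //.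
  by congr vtx; lia.
(* A degenerate [y] has [q > 0], which excludes the second alternative of [xq]. *)
have xa : has_apex x by case/orP: xq => // /eqP; lia.
exists (p + i)%N; first by lia.
rewrite !vtx_join; [|lia..]; rewrite /join_vtx !vtx_apex ?unlift_none //; [|lia..].
by rewrite -[LHS]/(vtx _ _) addKn -addnS addKn.
Qed.

(** * From cochains on the join to blown-up cochains *)

Variables (R : comNzRingType) (n : nat).
Implicit Types (p q : nat).

(** One formula covers both cases, since [join n x y] is [x] when [x] has no apex and [q = 0]. The
    coefficients set to 0 for [q > 0] without apex are those of positive perverse degree. *)
Definition join_cochain (c : Delta K n -> R) : bicochain R (cone s) (base s) :=
  fun p q x y =>
    if (p + q == n)%N && (has_apex x || (q == 0%N)) then c (join n x y) else 0.

Lemma join_cochain0 (c : Delta K n -> R) p q (x : cone s p) (y : base s q) :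
  ((p + q == n)%N -> has_apex x || (q == 0%N) -> False) -> join_cochain c x y = 0.
Proof. by rewrite /join_cochain; case: eqP => // _; case: orP => // ? /(_ erefl erefl). Qed.

Lemma join_cochainE (c : Delta K n -> R) p q (x : cone s p) (y : base s q) :
  (p + q)%N = n -> has_apex x || (q == 0%N) -> join_cochain c x y = c (join n x y).
Proof. by rewrite /join_cochain => -> ->; rewrite eqxx. Qed.

Lemma has_apex_dface p (x : cone s p.+1) (i : 'I_p.+2) :
  has_apex (dface i x) -> has_apex x.
Proof.
by case/existsP => j; rewrite dcompE => xj; apply/existsP; exists (coface i j).
Qed.

Lemma has_apex_dface_in p (x : cone s p.+1) (i : 'I_p.+2) :
  (i <= p)%N -> has_apex (dface i x) = has_apex x.
Proof.
move=> ip; rewrite !has_apexE vtx_coface // /bump ip add1n.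
by [].
Qed.

(** The faces of [x] and then those of [y] run through the faces of the join, and the sign in
    [bicob2] is exactly the shift of the face index. If [q > 0], the face of [x] opposite to the
    apex contributes 0. *)
Lemma bicob_join_cochain (c : Delta K n -> R) p q (x : cone s p) (y : base s q) :
  (p + q)%N = n.+1 -> single_apex x \/ ~~ has_apex x /\ q = 0%N ->
  bicob (join_cochain c) x y = coboundary c (join n.+1 x y : Delta K n.+1).
Proof.
have -> : coboundary c (join n.+1 x y : Delta K n.+1) =
    \sum_(0 <= i < n.+2) (-1) ^+ i * c (dcomp (join n.+1 x y) (coface (inord i))).
  by rewrite big_mkord; apply: eq_bigr => i _; rewrite inord_val.
case: p x => [|p] x pqn xa; case: q y pqn xa => [|q] y pqn xa; rewrite /bicob /=.
- by lia.
- case: xa => [xa|[_]//]; have nq : q = n by lia.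
  subst q; rewrite add0r expr0 mul1r big_mkord; apply: eq_bigr => j _.
  by rewrite join_cochainE ?(xa.1) // (@join_dface_base n).
- have np : p = n by lia.
  subst p; rewrite addr0 big_mkord; apply: eq_bigr => i _.
  by rewrite join_cochainE ?eqxx ?orbT ?addn0 // (@join_dface_cone n) ?addn0 ?orbT.
- case: xa => [xa|[_]//]; have [xap xn] := xa.
  rewrite (@big_cat_nat _ _ _ p.+1) //=; last by lia.
  congr (_ + _).
    rewrite big_mkord /coboundary big_ord_recr /= [X in _ * X]join_cochain0.
      rewrite mulr0 addr0; apply: eq_bigr => i _; have ip := ltn_ord i.
      have iN : (widen_ord (leqnSn p.+1) i <= p)%N by [].
      rewrite join_cochainE ?has_apex_dface_in ?xap //; last by lia.
      by rewrite (@join_dface_cone n) ?iN //; lia.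
    move=> _; rewrite orbF has_apexE => /eqP e.
    have := xn p (leqnn _); move: e; rewrite vtx_coface // /bump ltnn add0n.
    by move=> ->; rewrite eqxx.
  rewrite [RHS](big_addn 0 n.+2 p.+1) (_ : (n.+2 - p.+1 = q.+2)%N); last by lia.
  rewrite big_mkord /coboundary mulr_sumr; apply: eq_bigr => j _.
  rewrite mulrA -exprD addnC join_cochainE ?xap //; last by lia.
  by rewrite (@join_dface_base n) // ?[(p.+1 + j)%N]addnC //; lia.
Qed.

Lemma binormalized_join_cochain (c : Delta K n -> R) :
  normalized c -> binormalized (join_cochain c).
Proof.
move=> cn p q x y xy; rewrite /join_cochain; case: ifP => // /andP[/eqP pqn xq].
exact/cn/join_degenerate.
Qed.

(** As for normalized cochains in general: the last two faces of [x] coincide and cancel, and all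
    other terms are evaluated at degenerate simplices. *)
Lemma bicob_join_cochain_apexes (c : Delta K n -> R) p q (x : cone s p.+1) (y : base s q) :
  normalized c -> vtx (sval x) p = ord_max -> vtx (sval x) p.+1 = ord_max ->
  bicob (join_cochain c) x y = 0.
Proof.
move=> /binormalized_join_cochain wn xp xp1.
have xd : degenerate x by apply/degenerate_fullface; exists p; rewrite ?xp.
rewrite /bicob [bicob2 _ _ _](_ : _ = 0) ?addr0; last first.
  case: q y => //= q y; rewrite /coboundary big1 ?mulr0 // => j _.
  by rewrite wn ?mulr0 //; left.
rewrite /= /coboundary !big_ord_recr /= big1 ?add0r => [|i _].
  have e (i : 'I_p.+2) : i = p :> nat -> dface i x = dface ord_max x.
    move=> ip; apply/val_inj/delta_vtx => l lp /=; rewrite !vtx_coface //= ip /bump.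
    case: (ltnP l p) => lp'; first by congr vtx; lia.
    by rewrite (_ : l = p) ?leqnn ?ltnn ?xp1 ?xp //; lia.
  by rewrite (e (widen_ord _ _)) // exprS mulN1r mulNr addrN.
have ip := ltn_ord i; rewrite wn ?mulr0 //; left; apply/degenerate_fullface.
exists p.-1; first by lia.
set i' := widen_ord _ _; have i'p : (i' <= p)%N by rewrite /=; lia.
have e l : vtx (sval (dface i' x)) l = vtx (sval x) (bump i l) by exact: vtx_coface_in.
have b1 : bump i p.-1 = p by rewrite /bump; lia.
have b2 : bump i p.-1.+1 = p.+1 by rewrite /bump; lia.
by rewrite !e b1 b2 xp xp1.
Qed.

Lemma single_apexVrepeated p (x : cone s p) :
  has_apex x -> single_apex x \/ exists2 i, (i < p)%N & vtx (sval x) i = ord_max.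
Proof.
move=> xa; case: (pselect (exists2 i, (i < p)%N & vtx (sval x) i = ord_max)).
  by right.
by move=> nx; left; split=> // i ip; apply/eqP => xi; apply: nx; exists i.
Qed.

(** Once the coboundary is known to vanish, its perverse condition is automatic. The vanishing is
    not covered by [bicob_join_cochain] when [x] repeats the apex, or has no apex while [q > 0]. *)
Lemma perv_cocycle_join (c : Delta K n -> R) :
  cocycle c -> perv_cocycle n (join_cochain c).
Proof.
case=> cn cz.
have wz p q (x : cone s p) (y : base s q) : bicob (join_cochain c) x y = 0.
  case: (eqVneq (p + q)%N n.+1) => pqn; last first.
    rewrite /bicob [X in X + _](_ : _ = 0) ?add0r.
      case: q y pqn => //= q y pqn; rewrite /coboundary big1 ?mulr0 // => j _.
      by rewrite join_cochain0 ?mulr0 //; lia.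
    case: p x pqn => //= p x pqn; rewrite /coboundary big1 // => j _.
    by rewrite join_cochain0 ?mulr0 //; lia.
  case: (boolP (has_apex x)) => xa.
    case: (single_apexVrepeated xa) => [xs|[i ip xi]].
      by rewrite bicob_join_cochain //; left.
    case: p x pqn xa ip xi => // p x pqn xa ip xi.
    apply: bicob_join_cochain_apexes; rewrite // -?has_apexE //.
      apply: val_inj; apply/eqP; rewrite eqn_leq leq_ord /=.
      by have := @vtx_le _ _ (sval x) i p ip; rewrite xi.
    by rewrite vtx_apex.
  case: q y pqn => [|q] y pqn; first by rewrite bicob_join_cochain //; right.
  (* No face of [x] has an apex either, so only the faces of [y] can contribute, and only if [y] is
     an edge. *)
  rewrite /bicob [X in X + _](_ : _ = 0) ?add0r; last first.
    case: p x pqn xa => //= p x pqn xa; rewrite /coboundary big1 // => j _.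
    rewrite join_cochain0 ?mulr0 // orbF => _ /has_apex_dface.
    by rewrite (negbTE xa).
  rewrite /= /coboundary; case: q y pqn => [|q] y pqn; last first.
    rewrite big1 ?mulr0 // => j _; rewrite join_cochain0 ?mulr0 // => _.
    by rewrite (negbTE xa).
  have pn : p = n by lia.
  subst p; rewrite !big_ord_recr big_ord0 /= add0r !join_cochainE ?orbT ?addn0 //.
  rewrite expr0 expr1 mul1r mulN1r.
  (* Without apex the join does not see [y], so both ends of the edge give the same value, with
     opposite signs. *)
  have -> : join n x (dface ord_max y) = join n x (dface (widen_ord (leqnSn 1) ord_max) y).
    apply: delta_vtx => l ln; rewrite !vtx_join // /join_vtx.
    case: unliftP => // xl; move: xa; rewrite has_apexE => /eqP[].
    apply: val_inj; apply/eqP; rewrite eqn_leq leq_ord /=.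
    by have := vtx_le (sval x) ln; rewrite xl.
  by rewrite subrr mulr0.
split=> //; split.
- exact: binormalized_join_cochain.
- by move=> p q x y pqn; apply: join_cochain0 => e; rewrite e in pqn.
- by move=> sr p q x y; case/negP: sr; exact: base_regular y.
- move=> p q x y; rewrite /perv_basis; case: ifP => // xa nz.
  rewrite leqn0; apply/eqP; case: (eqVneq q 0%N) => // q0; case: nz.
  by apply: join_cochain0; rewrite xa (negbTE q0).
- by move=> p q x y; rewrite wz.
Qed.
End Join.

(** * Splitting a simplex at its first vertex over 1 *)

Section Split.
Variables (s : simplex1) (sreg : regular s).
Local Notation K := (sdim s).

Definition over1 (j : 'I_K.+1) : bool := s j == ord_max.

Lemma over1_le (i j : 'I_K.+1) : (i <= j)%N -> over1 i -> over1 j.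
Proof.
move=> ij /eqP si; apply/eqP/val_inj/eqP; rewrite eqn_leq leq_ord /=.
by have := delta_mono s ij; rewrite si.
Qed.

Lemma over1N j : over1 j = false -> s j = ord0.
Proof.
move=> /negbT h; apply: val_inj; have := ltn_ord (s j).
by move: h; rewrite /over1 -val_eqE /=; lia.
Qed.

Section Cut.
Variables (n : nat) (z : delta n K).

(** The value is [n + 1] when no vertex of [z] lies over 1. *)
Definition cut : nat := find (fun i => over1 (vtx z i)) (iota 0 n.+1).

Lemma cut_le : (cut <= n.+1)%N.
Proof. by rewrite -[X in (_ <= X)%N](size_iota 0); exact: find_size. Qed.

Lemma over1_cut i : (i <= n)%N -> over1 (vtx z i) = (cut <= i)%N.
Proof.
move=> iN; case: leqP => ci.
  have hs : has (fun i => over1 (vtx z i)) (iota 0 n.+1).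
    by rewrite has_find size_iota; apply: leq_ltn_trans ci _.
  apply: over1_le (nth_find 0%N hs); rewrite nth_iota; first exact: vtx_le.
  exact: leq_ltn_trans ci _.
by have := before_find 0%N ci; rewrite nth_iota ?add0n.
Qed.

Lemma cut_uniq m : (m <= n.+1)%N -> (forall i, (i <= n)%N -> over1 (vtx z i) = (m <= i)%N) ->
  cut = m.
Proof.
move=> mn h; have c := cut_le; apply/eqP; rewrite eqn_leq; apply/andP; split.
  case: (eqVneq m n.+1) => [->//|mn1]; have mN : (m <= n)%N by lia.
  by rewrite -over1_cut // h.
case: (eqVneq cut n.+1) => [->//|mn1]; have mN : (cut <= n)%N by lia.
by rewrite -h // over1_cut.
Qed.

(** If [cut <= n], the cone part consists of [cut] vertices and the apex; if [cut = n + 1], it is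
    [z] itself, of dimension [n]. *)
Definition cut_dim : nat := minn cut n.

Definition split_cone_vtx (i : nat) : 'I_K.+2 :=
  if over1 (vtx z i) then ord_max else lift ord_max (vtx z i).

Lemma split_cone_mono i j : (i <= j)%N -> (split_cone_vtx i <= split_cone_vtx j)%N.
Proof.
move=> ij; have zij := vtx_le z ij; rewrite /split_cone_vtx.
case: ifP => [/(over1_le zij) ->//|_].
by case: ifP => _; [exact: leq_ord | rewrite !lift_max].
Qed.

Definition split_cone_delta : delta cut_dim K.+1 := delta_of_nat cut_dim split_cone_mono.

Lemma split_cone_in : [forall i, @in_cone s (split_cone_delta i)].
Proof.
apply/forallP => i; rewrite -vtx_ord vtx_of_nat /split_cone_vtx /in_cone.
by case: ifP; rewrite ?unlift_none // liftK => /over1N ->.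
Qed.

Definition split_cone : cone s cut_dim := exist _ split_cone_delta split_cone_in.

(** When [z] lies over 0 it leaves nothing for the base; the last vertex of [s], which is over 1 by
    regularity, serves as the base point. *)
Definition split_base_vtx (i : nat) : 'I_K.+1 :=
  if over1 (vtx z n) then vtx z (cut_dim + i) else ord_max.

Lemma split_base_mono i j : (i <= j)%N -> (split_base_vtx i <= split_base_vtx j)%N.
Proof.
by move=> ij; rewrite /split_base_vtx; case: ifP => // _; apply: vtx_le; rewrite leq_add2l.
Qed.

Definition split_base_delta : delta (n - cut_dim)%N K :=
  delta_of_nat (n - cut_dim)%N split_base_mono.

Lemma split_base_in : [forall i, @in_base s (split_base_delta i)].
Proof.
apply/forallP => i; rewrite -vtx_ord vtx_of_nat /split_base_vtx /in_base.
case: ifP => //; rewrite over1_cut // => cn; rewrite -/(over1 _) over1_cut.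
  by rewrite /cut_dim; lia.
by rewrite /cut_dim; lia.
Qed.

Definition split_base : base s (n - cut_dim)%N := exist _ split_base_delta split_base_in.

Lemma split_dim : (cut_dim + (n - cut_dim))%N = n.
Proof. by rewrite /cut_dim; lia. Qed.

Lemma vtx_split_cone i : (i <= cut_dim)%N -> vtx (sval split_cone) i = split_cone_vtx i.
Proof. by move=> h; rewrite vtx_of_nat; congr split_cone_vtx; lia. Qed.

Lemma join_split : join n split_cone split_base = z.
Proof.
have c := cut_le; apply: delta_vtx => i iN; rewrite vtx_join // /join_vtx.
case: (leqP i cut_dim) => ic.
  rewrite vtx_split_cone // /split_cone_vtx over1_cut //.
  case: leqP => ci; rewrite ?unlift_none ?liftK // vtx_of_nat /split_base_vtx.
  have cn : (cut <= n)%N by lia.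
  by rewrite over1_cut // cn; congr vtx; move: ic; rewrite /cut_dim; lia.
have cn : (cut <= n)%N by move: ic; rewrite /cut_dim; lia.
rewrite (vtx_last _ (ltnW ic)) vtx_split_cone // /split_cone_vtx over1_cut; last first.
  by rewrite /cut_dim; lia.
rewrite {1}/cut_dim leq_min leqnn cn unlift_none vtx_of_nat /split_base_vtx.
by rewrite over1_cut // cn; congr vtx; lia.
Qed.

Lemma split_apex :
  single_apex split_cone \/ ~~ has_apex split_cone /\ (n - cut_dim)%N = 0%N.
Proof.
have c := cut_le; have cd : (cut_dim <= n)%N by exact: geq_minr.
have lastE : has_apex split_cone = (cut <= n)%N.
  rewrite has_apexE vtx_split_cone // /split_cone_vtx over1_cut //.
  rewrite {1}/cut_dim leq_min leqnn /=; case: leqP => _; first by rewrite eqxx.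
  by apply/negbTE; rewrite eq_sym neq_lift.
rewrite /single_apex lastE; case: leqP => cn; [left | right; split=> //].
  split=> // i ic; rewrite vtx_split_cone; last exact: ltnW.
  rewrite /split_cone_vtx over1_cut; last by lia.
  by rewrite leqNgt (leq_trans ic (geq_minl _ _)) /= eq_sym neq_lift.
by rewrite /cut_dim; lia.
Qed.

(** Two equal consecutive vertices lie on the same side of the cut, so one of the two parts inherits
    the repetition. *)
Lemma split_degenerate :
  degenerate (z : Delta K n) -> degenerate split_cone \/ degenerate split_base.
Proof.
have c := cut_le.
case/degenerate_Delta => i iN e; case: (leqP cut i) => ci.
  right; apply/degenerate_fullface; exists (i - cut)%N.
    by rewrite /cut_dim; lia.
  have cn : (cut <= n)%N by lia.
  rewrite !vtx_of_nat /split_base_vtx over1_cut // cn.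
  have -> : (cut_dim + minn (i - cut) (n - cut_dim))%N = i by rewrite /cut_dim; lia.
  have -> : (cut_dim + minn (i - cut).+1 (n - cut_dim))%N = i.+1 by rewrite /cut_dim; lia.
  exact: e.
left; apply/degenerate_fullface; exists i.
  have h : ~~ (cut <= i)%N by lia.
  have : over1 (vtx z i.+1) = false by rewrite -e over1_cut //; lia.
  by rewrite over1_cut // /cut_dim; lia.
have : over1 (vtx z i.+1) = false by rewrite -e over1_cut //; lia.
rewrite over1_cut // => ci1.
rewrite !vtx_split_cone; [|rewrite /cut_dim; lia..].
by rewrite /split_cone_vtx e.
Qed.
End Cut.

Lemma cut_dim_join n p q (x : cone s p) (y : base s q) :
  (p + q)%N = n -> single_apex x \/ ~~ has_apex x /\ q = 0%N ->
  cut_dim (join n x y) = p.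
Proof.
move=> pqn xa.
have h i j : unlift ord_max (vtx (sval x) i) = Some j -> over1 j = false.
  by move=> /coneP; rewrite /over1 => ->.
rewrite /cut_dim; case: xa => [[xa xs]|[xa q0]].
  rewrite (@cut_uniq _ _ p); [lia | lia |] => i iN.
  rewrite vtx_join // /join_vtx; case: leqP => ip.
    by rewrite vtx_apex // unlift_none /over1 baseP.
  have := xs i ip; case: unliftP (@h i) => [j -> hj _|->]; first exact: hj.
  by rewrite eqxx.
rewrite (@cut_uniq _ _ p.+1); [lia | lia |] => i iN.
rewrite vtx_join // /join_vtx; case: unliftP (@h i) => [j _ -> //|xi _].
  by apply/esym/negbTE; lia.
move: xa; rewrite has_apexE => /eqP[]; apply: val_inj; apply/eqP.
rewrite eqn_leq leq_ord /=; have ip : (i <= p)%N by lia.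
by have := vtx_le (sval x) ip; rewrite xi.
Qed.

(** * Recovering a cochain from a blown-up cocycle *)

Variables (R : comNzRingType) (n : nat).

Lemma join_cochain_inj (c c' : Delta K n -> R) :
  (forall p q (x : cone s p) (y : base s q), join_cochain c x y = join_cochain c' x y) ->
  c =1 c'.
Proof.
move=> e z; have := e _ _ (split_cone z) (split_base z).
have a : has_apex (split_cone z) || (n - cut_dim z == 0)%N.
  by case: (split_apex z) => [[->//]|[_ ->]]; rewrite orbT.
by rewrite !join_cochainE ?split_dim // join_split.
Qed.

Section SplitCochain.
Variable w : bicochain R (cone s) (base s).

(** The dimensions of the parts of a split join are only propositionally [p] and [q]; comparing
    vertices avoids transports. *)
Lemma bicochain_ext p q p' q' (x : cone s p) (y : base s q) (x' : cone s p') (y' : base s q') :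
  p = p' -> q = q' ->
  (forall i, (i <= p)%N -> vtx (sval x) i = vtx (sval x') i) ->
  (forall i, (i <= q)%N -> vtx (sval y) i = vtx (sval y') i) ->
  w x y = w x' y'.
Proof.
move=> pp qq; subst p' q' => /delta_vtx xx /delta_vtx yy.
by congr w; exact: val_inj.
Qed.

Definition split_cochain (z : Delta K n) : R := w (split_cone z) (split_base z).

Hypothesis wz : perv_cocycle n w.

Lemma perv_cocycle_noapex p q (x : cone s p) (y : base s q) :
  ~~ has_apex x -> (0 < q)%N -> w x y = 0.
Proof.
move=> xa q0; apply/eqP/negPn/negP => /eqP /(pc_perv wz.1).
by rewrite /perv_basis (negbTE xa) leqn0; lia.
Qed.

(* The cocycle condition on x (x) [y, y'] makes w x _ constant on the vertices
   of the base. *)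
Lemma perv_cocycle_base_const p (x : cone s p) (y y' : base s 0) :
  ~~ has_apex x -> (vtx (sval y) 0 <= vtx (sval y') 0)%N -> w x y = w x y'.
Proof.
move=> xa yy.
pose F i := if i == 0%N then vtx (sval y) 0 else vtx (sval y') 0.
have Fm i j : (i <= j)%N -> (F i <= F j)%N.
  by rewrite /F; case: i j => [|i] [|j].
have ein : [forall i, @in_base s (delta_of_nat 1 Fm i)].
  apply/forallP => i; rewrite -vtx_ord vtx_of_nat /F /in_base.
  by case: ifP; rewrite baseP.
pose e : base s 1 := exist _ (delta_of_nat 1 Fm) ein.
have := wz.2 _ _ x e; rewrite /bicob [X in X + _](_ : _ = 0) ?add0r; last first.
  case: p x xa => //= p x xa; rewrite /coboundary big1 // => i _.
  rewrite perv_cocycle_noapex ?mulr0 //; apply: contra xa; exact: has_apex_dface.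
rewrite /= /coboundary !big_ord_recr big_ord0 /= add0r expr0 mul1r expr1 mulN1r.
have -> : dface (widen_ord (leqnSn 1) ord_max) e = y'.
  apply/val_inj/delta_vtx => i; rewrite leqn0 => /eqP ->.
  by rewrite vtx_coface // vtx_of_nat.
have -> : dface ord_max e = y.
  apply/val_inj/delta_vtx => i; rewrite leqn0 => /eqP ->.
  by rewrite vtx_coface // vtx_of_nat.
by move=> /(congr1 ( *%R ((-1) ^+ p))); rewrite signrMK mulr0 => /eqP; rewrite subr_eq0 => /eqP.
Qed.

Lemma split_cochain_normalized : normalized split_cochain.
Proof. by move=> z zd; apply: (pc_norm wz.1); exact: split_degenerate. Qed.

Lemma split_cochain_join p q (x : cone s p) (y : base s q) :
  (p + q)%N = n -> single_apex x \/ ~~ has_apex x /\ q = 0%N ->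
  split_cochain (join n x y) = w x y.
Proof.
move=> pqn xa; have cd := cut_dim_join y pqn xa.
have xx i : (i <= p)%N ->
    vtx (sval (split_cone (join n x y))) i = vtx (sval x) i.
  move=> ip; rewrite vtx_split_cone ?cd // /split_cone_vtx vtx_join; last by lia.
  rewrite /join_vtx; case: unliftP (@coneP _ _ x i) => [j -> /(_ _ erefl) sj|->].
    by rewrite /over1 sj.
  by rewrite /over1 baseP.
case: xa => [[xa xs]|[xa q0]].
  apply: bicochain_ext; [exact: cd | by rewrite cd; lia | by move=> i ip; apply: xx; lia |].
  move=> i iq; rewrite vtx_of_nat /split_base_vtx cd.
  have e j : (p <= j)%N -> (j <= n)%N -> vtx (join n x y) j = vtx (sval y) (j - p)%N.
    by move=> pj jn; rewrite vtx_join // /join_vtx vtx_apex // unlift_none.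
  rewrite !e; [|lia..]; rewrite /over1 baseP eqxx.
  by congr vtx; lia.
subst q; rewrite /split_cochain.
(* The join has forgotten [y], and splitting returns some vertex [y'] of the base;
   [perv_cocycle_base_const] makes the choice irrelevant. *)
have [y' ->] : exists y' : base s 0,
    w (split_cone (join n x y)) (split_base (join n x y)) = w x y'.
  have q0 : (n - cut_dim (join n x y))%N = 0%N by lia.
  move: (split_base _); rewrite q0 => y'; exists y'.
  by apply: bicochain_ext => // i ip; apply: xx; lia.
by case: (leqP (vtx (sval y) 0) (vtx (sval y') 0)) => [|/ltnW] /(perv_cocycle_base_const xa).
Qed.

Lemma join_split_cochain p q (x : cone s p) (y : base s q) :
  join_cochain split_cochain x y = w x y.
Proof.
case: (eqVneq (p + q)%N n) => pqn; last first.
  by rewrite (pc_deg wz.1) // join_cochain0 // (negbTE pqn).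
case: (boolP (has_apex x || (q == 0%N))) => xq; last first.
  rewrite join_cochain0 ?(negbTE xq) //; move: xq; rewrite negb_or => /andP[xa q0].
  by rewrite perv_cocycle_noapex // lt0n.
case: (boolP (has_apex x)) => xa; last first.
  rewrite join_cochainE // split_cochain_join //; right; split=> //.
  by move: xq; rewrite (negbTE xa) => /eqP.
case: (single_apexVrepeated xa) => [xs|[i ip xi]].
  by rewrite join_cochainE // split_cochain_join //; left.
have xd : degenerate x.
  apply/degenerate_fullface; exists i; rewrite // xi; apply: val_inj; apply/eqP.
  rewrite eqn_leq leq_ord andbT /=.
  by have := vtx_le (sval x) (leqnSn i); rewrite xi.
rewrite (pc_norm wz.1); last by left.
by apply: (binormalized_join_cochain split_cochain_normalized); left.
Qed.

(** Every simplex [z] of dimension [n + 1] is the join of its two parts, where the coboundary equals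
    that of [w]. *)
Lemma split_cochain_cocycle : cocycle split_cochain.
Proof.
split=> [|z]; first exact: split_cochain_normalized.
rewrite -[z]join_split -bicob_join_cochain ?split_dim //; last exact: split_apex.
have -> : join_cochain split_cochain = w.
  by do 4 apply: functional_extensionality_dep => ?; exact: join_split_cochain.
exact: wz.2.
Qed.
End SplitCochain.
End Split.

(** * Naturality and the comparison isomorphism *)

Lemma join_map (s t : simplex1) (f : @Defs.hom Simplices s t) n p q
    (x : cone s p) (y : base s q) :
  join n (cone_map f p x) (base_map f q y) = dcomp (sval f) (join n x y).
Proof.
apply: delta_vtx => i iN; rewrite vtx_dcomp !vtx_join // /join_vtx.
have -> : vtx (sval (cone_map f p x)) i = cone_fun (sval f) (vtx (sval x) i).
  exact: cone_mapE.
rewrite /cone_fun; case: (unlift ord_max (vtx (sval x) i)) => [j|]; first by rewrite liftK.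
by rewrite unlift_none vtx_dcomp.
Qed.

Section Comparison.
Variables (R : comNzRingType) (n : nat).
Local Notation P := (ext_pt (@restr Simplices regular (fib (Delta1_EM R n)))).

(** An element of [P s] is a family indexed by proofs of regularity; any simplex [y] of the base
    supplies such a proof, so no case distinction is needed. *)
Definition EM_perv (s : Simplices) (u : P s) : bicochain R (cone s) (base s) :=
  fun p q x y => join_cochain (sval (sval (u (base_regular y))).2) x y.

Lemma EM_perv_regular (s : Simplices) (u : P s) (h : regular s) :
  EM_perv u = join_cochain (sval (sval (u h)).2).
Proof.
do 4 apply: functional_extensionality_dep => ?; rewrite /EM_perv.
by rewrite (bool_irrelevance (base_regular _) h).
Qed.

Lemma EM_perv_cocycle (s : Simplices) (u : P s) : perv_cocycle n (EM_perv u).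
Proof.
case: (boolP (regular s)) => [h|nh].
  rewrite (EM_perv_regular u h); apply: perv_cocycle_join.
  exact: (svalP (sval (u h)).2).
have noy q (y : base s q) : False by case/negP: nh; exact: base_regular y.
by split=> [|p q x y]; [split=> [||_||] p q x y | ]; case: (noy q y).
Qed.

Lemma EM_perv_nat (s t : Simplices) (f : @Defs.hom Simplices s t) (u : P t) :
  exist _ (EM_perv (act f u)) (EM_perv_cocycle (act f u)) =
  @act _ (KpervPsh R n) s t f (exist _ (EM_perv u) (EM_perv_cocycle u)).
Proof.
apply: eq_exist; apply: functional_extensionality_dep => p.
apply: functional_extensionality_dep => q.
apply: functional_extensionality_dep => x; apply: functional_extensionality_dep => y.
have h := base_regular y.
rewrite -[RHS]/(EM_perv u (cone_map f p x) (base_map f q y)).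
rewrite (EM_perv_regular _ h) (EM_perv_regular u (regular_hom f h)).
by rewrite /join_cochain has_apex_map join_map.
Qed.

Definition EM_perv_map : pmap P (KpervPsh R n) :=
  @PMap Simplices P (KpervPsh R n) (fun s u => exist _ (EM_perv u) (EM_perv_cocycle u))
    EM_perv_nat.

Lemma EM_perv_iso : iso1 (total_map EM_perv_map).
Proof.
apply: total_map_iso => s.
  move=> u v e; apply: functional_extensionality_dep => h.
  have : EM_perv u = EM_perv v := congr1 sval e.
  rewrite !(EM_perv_regular _ h) => {}e.
  have := @join_cochain_inj s h R n (sval (sval (u h)).2) (sval (sval (v h)).2).
  case: (u h) (v h) e => [[a [c hc]] /= ua] [[b [d hd]] /= vb] e cd.
  (* The Delta[1]-components are both [s], so only the cocycles remain to be compared. *)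
  apply: eq_exist; subst a; subst b; congr pair; apply: eq_exist; apply: funext.
  by apply: cd => p q x y; rewrite e.
case=> w wz; case: (boolP (regular s)) => [h|nh].
  pose c : EM R n (sdim s) := exist _ _ (split_cochain_cocycle h wz).
  exists (fun h' => exist (fun u => psi (Delta1_EM R n) _ u = s) (smap s, c) erefl).
  apply: eq_exist; rewrite (EM_perv_regular _ h).
  by do 4 apply: functional_extensionality_dep => ?; exact: join_split_cochain.
have [u _] := ext_pt_nonregular (@restr Simplices regular (fib (Delta1_EM R n))) nh.
exists u; apply: eq_exist; do 4 apply: functional_extensionality_dep => ?.
by case/negP: nh; apply: base_regular; eassumption.
Qed.

Lemma cocycle0 k : @cocycle R (Delta k) n (fun=> 0).
Proof.
split=> // x; rewrite /coboundary big1 // => i _; exact: mulr0.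
Qed.

End Comparison.

(** * The quotient by the part over 0 *)

Lemma nR_nonregular (K : sset1) k (u v : nR K k) :
  projT1 u = projT1 v -> ~~ regular (Simplex1 (projT1 u)) -> u = v.
Proof.
case: u v => [s u] [t v] /= st ns; subst t; congr existT.
have [c hc] := ext_pt_nonregular (@restr Simplices regular (fib K)) ns.
by rewrite (hc u) (hc v).
Qed.

Lemma nR_elt_eq (K : sset1) k (u v : K k) :
  nR_elt u = nR_elt v <-> collapse_rel u v.
Proof.
split=> [e|[->//|[hu hv]]].
  have ep : psi K k u = psi K k v := congr1 (@projT1 _ _) e.
  case: (boolP (regular (Simplex1 (psi K k u)))) => [h|nh]; [left|right].
    (* Reading the simplex of [K] off a regular element of [nR K] by a function of the whole pair
       avoids transport along [ep]. *)
    pose val (x : nR K k) (h : regular (Simplex1 (projT1 x))) : K k :=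
      sval (projT2 x h).
    have key (x y : nR K k) : x = y -> forall hx hy, val x hx = val y hy.
      by move=> -> hx hy; congr val; exact: bool_irrelevance.
    have h' : regular (Simplex1 (psi K k v)) by rewrite -ep.
    exact: (key _ _ e h h').
  have hu : over0 u.
    move=> i; apply: val_inj => /=; move: nh; rewrite /regular /= => nh.
    have le : (psi K k u i <= psi K k u ord_max)%N.
      by apply: delta_mono; rewrite -ltnS.
    have := ltn_ord (psi K k u ord_max); move: nh; rewrite -val_eqE /=; lia.
  by split=> // i; rewrite -ep.
have ep : psi K k u = psi K k v by apply: deltaP => i; rewrite hu hv.
by apply: nR_nonregular; rewrite // /regular /= hu.
Qed.

Section CollapseMap.
Variable K : sset1.

Lemma nR_unit_collapse k (u v : K k) : collapse_rel u v -> nR_unit K k u = nR_unit K k v.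
Proof. by move/nR_elt_eq. Qed.

Definition collapse_nR_pmap : pmap (collapse K) (nR K) :=
  squot_lift (@collapse_refl K) (@collapse_sym K) (@collapse_trans K)
    (@collapse_act K) nR_unit_collapse.

Definition collapse_nR : map1 (collapse K) (nR K) :=
  @Map1 (collapse K) (nR K) collapse_nR_pmap (fun _ _ => erefl).

Lemma collapse_nR_pi : map1_comp collapse_nR (collapse_pi K) = nR_unit K.
Proof.
apply: map1_eq => k u; apply: nR_unit_collapse.
apply/(to_quoP (@collapse_refl K) (@collapse_sym K) (@collapse_trans K)).
exact: of_quoK.
Qed.

(** [nR K] has one point over each non-regular simplex even if [K] has none there; the hypothesis
    makes these points images. *)
Lemma collapse_nR_iso :
  (forall k (s : delta k 1), ~~ regular (Simplex1 s) -> exists u, psi K k u = s) ->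
  iso1 collapse_nR.
Proof.
move=> K0; apply: levelwise_bij_iso1 => k.
  move=> c d /nR_elt_eq /(to_quoP (@collapse_refl K) (@collapse_sym K) (@collapse_trans K)).
  by rewrite !of_quoK.
move=> v; have [u <-] : exists u, nR_elt u = v.
  case: v => s v; case: (boolP (regular (Simplex1 s))) => [h|nh].
    have [u us vh] : exists2 u : K k, psi K k u = s & forall h', sval (v h') = u.
      exists (sval (v h)); first exact: svalP (v h).
      by move=> h'; congr (sval (v _)); exact: bool_irrelevance.
    exists u; subst s.
    congr existT; apply: functional_extensionality_dep => h'.
    by case: (v h') (vh h') => u' hu' /= uu; apply: eq_exist.
  have [u us] := K0 _ _ nh; exists u.
  by apply: nR_nonregular; rewrite /= us.
exists (to_quo (@collapse_refl K) (@collapse_sym K) (@collapse_trans K) u).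
exact: (congr1 (fun f : map1 _ _ => f k u) collapse_nR_pi).
Qed.
End CollapseMap.

Theorem proposition6p9 (R : idomainType) (hR : dedekind R) (n : nat) :
  homotopy_equivalent (Kperv R n) (nR (Delta1_EM R n)) /\
  exists f : map1 (collapse (Delta1_EM R n)) (nR (Delta1_EM R n)),
    iso1 f /\ map1_comp f (collapse_pi (Delta1_EM R n)) = nR_unit (Delta1_EM R n).
Proof.
split; first exact/iso1_homotopy_equivalent/EM_perv_iso.
exists (collapse_nR (Delta1_EM R n)); split; last exact: collapse_nR_pi.
apply: collapse_nR_iso => k s _.
(* The zero cocycle gives a simplex over every [s]. *)
by exists (s, exist _ _ (cocycle0 R n k)).
Qed.
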